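(* Let $(\Delta,\mathcal D,\mathbb P)$ be a probability space, $\mathcal X\subseteq\mathbb R^d$, $f:\mathcal X\to\mathbb R$, $g:\mathcal X\to\mathbb R^q$, $b:\Delta\to\mathbb R^q$, and let $(\delta_1,\dots,\delta_N)$ be a data-set of scenarios drawn independently from $(\Delta,\mathcal D,\mathbb P)$. Consider the scenario program $$\min_{x\in\mathcal X} f(x)\quad\text{s.t. } g(x)\le b(\delta_i),\ i=1,\dots,N, \qquad (\mathrm{SP})$$ and, associated with the same data-set, the convex scenario program $$\max_{\xi\in\mathbb R^q}\ \sum_{\ell=1}^q \xi_\ell\quad\text{s.t. } \xi_\ell\le b_\ell(\delta_i),\ \ell=1,\dots,q,\ i=1,\dots,N, \qquad (\mathrm{CSP})$$ with (unique) optimal solution $\xi_N^\star$. Then, for any probability $\mathbb P$ and any data-set $(\delta_1,\dots,\delta_N)$, the risk of any possibly sub-optimal (feasible) solution $\hat x_N^\star$ of (SP) is upper bounded by the risk of the optimal solution $\xi_N^\star$ of (CSP): $$V(\hat x_N^\star)\le V'(\xi_N^\star).$$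
   Context: Vector inequalities are componentwise; $g_\ell,b_\ell$ denote the $\ell$-th components of $g,b$, and $N,q\ge 1$. No convexity of $\mathcal X$, $f$ or $g$ is assumed. A ''possibly sub-optimal solution'' $\hat x_N^\star$ of (SP) is any point of $\mathcal X$ satisfying all constraints of (SP), not necessarily a minimizer. Standing assumption: (SP) is feasible with probability one, for every $N$. The risk of $x\in\mathcal X$ is $V(x)=\mathbb P\{\delta\in\Delta:\ g(x)\not\le b(\delta)\}$. The risk of $\xi\in\mathbb R^q$ for (CSP) is $V'(\xi)=\mathbb P\{\delta\in\Delta:\ \xi\not\le b(\delta)\}$. The program (CSP) is always feasible and has the unique solution $\xi_N^\star$ with components $\xi_{N,\ell}^\star=\min_{i=1,\dots,N}b_\ell(\delta_i)$, $\ell=1,\dots,q$. As is implicit in writing these probabilities, the sets involved are assumed measurable. *)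

(* Defs.v *)
From HB Require Import structures.
From mathcomp Require Import all_boot all_order all_algebra.
From mathcomp Require Import all_classical all_reals all_analysis.

Set Implicit Arguments.
Unset Strict Implicit.
Unset Printing Implicit Defensive.

Import Order.TTheory GRing.Theory Num.Theory.

Local Open Scope classical_set_scope.
Local Open Scope ring_scope.

Definition rv_le (R : realType) (q : nat) (u v : 'rV[R]_q) : Prop :=
  forall l : 'I_q, u 0 l <= v 0 l.

Section scenario_programs.
Context (R : realType) (disp : measure_display) (Delta : measurableType disp).
Context (d q N : nat) (X : set 'rV[R]_d).
Implicit Types (P : probability Delta R) (b : Delta -> 'rV[R]_q).
Implicit Types (delta : N.-tuple Delta) (xi : 'rV[R]_q).

(* Feasibility does not involve the objective f of the program. An element of
   (the subtype associated with) X lies in X by construction. *)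
Definition sp_feasible (g : X -> 'rV[R]_q) b delta (x : X) : Prop :=
  forall i : 'I_N, rv_le (g x) (b (tnth delta i)).

Definition sp_violation (g : X -> 'rV[R]_q) b (x : X) : set Delta :=
  [set y | ~ rv_le (g x) (b y)].

Definition sp_risk P (g : X -> 'rV[R]_q) b (x : X) : \bar R :=
  P (sp_violation g b x).

Definition csp_feasible b delta xi : Prop :=
  forall (l : 'I_q) (i : 'I_N), xi 0 l <= b (tnth delta i) 0 l.

Definition csp_objective xi : R := \sum_(l < q) xi 0 l.

Definition csp_optimal b delta xi : Prop :=
  csp_feasible b delta xi /\
  forall xi', csp_feasible b delta xi' -> csp_objective xi' <= csp_objective xi.

Definition csp_violation b xi : set Delta := [set y | ~ rv_le xi (b y)].

Definition csp_risk P b xi : \bar R := P (csp_violation b xi).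

End scenario_programs.

Section csp_solution.
Context (R : realType) (disp : measure_display) (Delta : measurableType disp).
Context (q N : nat).
Variables (b : Delta -> 'rV[R]_q) (delta : N.+1.-tuple Delta).

Definition csp_min : 'rV[R]_q :=
  \row_l \big[Num.min/b (tnth delta ord0) 0 l]_(i < N.+1) b (tnth delta i) 0 l.

Lemma csp_min_feasible : csp_feasible b delta csp_min.
Proof. by move=> l i; rewrite mxE; apply: bigmin_le_cond. Qed.

Lemma csp_feasible_le_min xi :
  csp_feasible b delta xi -> rv_le xi csp_min.
Proof.
by move=> xiF l; rewrite mxE; apply: le_bigmin => [|i _]; exact: xiF.
Qed.

Lemma csp_optimalP xi : csp_optimal b delta xi <-> xi = csp_min.
Proof.
split=> [[xiF xiM]|->].
  have le_xi := csp_feasible_le_min xiF.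
  have eq_sum : csp_objective xi = csp_objective csp_min.
    apply/eqP; rewrite eq_le (xiM _ csp_min_feasible) andbT.
    by apply: ler_sum => l _; exact: le_xi.
  have sum0 : \sum_(l < q) (csp_min 0 l - xi 0 l) = 0.
    by rewrite sumrB; apply/eqP; rewrite subr_eq0; apply/eqP/esym.
  apply/rowP => l; apply/esym/eqP; rewrite -subr_eq0; apply/eqP.
  by apply: (psumr_eq0P _ sum0) => // k _; rewrite subr_ge0; exact: le_xi.
split; first exact: csp_min_feasible.
by move=> xi' /csp_feasible_le_min le_xi; apply: ler_sum => l _; exact: le_xi.
Qed.

End csp_solution.

Section iid_law.
Context (R : realType) (disp : measure_display) (Delta : measurableType disp).

Section cons_tuple_mfun.
Context (n : nat).

Definition cons_pair (z : Delta * n.-tuple Delta) : n.+1.-tuple Delta :=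
  [tuple of z.1 :: z.2].

Lemma measurable_cons_pair : measurable_fun setT cons_pair.
Proof. by apply: measurable_cons; [exact: measurable_fst|exact: measurable_snd]. Qed.

HB.instance Definition _ :=
  isMeasurableFun.Build _ _ _ _ cons_pair measurable_cons_pair.

Definition cons_mfun : {mfun (Delta * n.-tuple Delta)%type >-> n.+1.-tuple Delta} :=
  cons_pair.

End cons_tuple_mfun.

(* Law P^n of a data-set of n independent draws from P, with the product
   sigma-algebra on n.-tuple Delta; see iid_law_rect. *)
Fixpoint iid_law (P : probability Delta R) (n : nat) :
    probability (n.-tuple Delta) R :=
  match n with
  | 0%N => dirac [tuple]
  | n'.+1 => distribution (P \x iid_law P n')%E (cons_mfun n')
  end.

Lemma iid_law_rect (P : probability Delta R) (n : nat) (A : 'I_n -> set Delta) :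
  (forall i, measurable (A i)) ->
  iid_law P n [set t | forall i, A i (tnth t i)] = (\prod_(i < n) P (A i))%E.
Proof.
elim: n A => [|n IHn] A mA /=.
  by rewrite big_ord0 diracE mem_set// => -[].
rewrite big_ord_recl -IHn; last by move=> i; exact: mA.
rewrite /distribution /pushforward /=.
pose B := [set t : n.-tuple Delta | forall i, A (lift ord0 i) (tnth t i)].
have -> : cons_pair (n:=n) @^-1` [set t | forall i, A i (tnth t i)] = A ord0 `*` B.
  apply/seteqP; split => -[x t] /= h.
    split=> [|i] /=; first by have := h ord0; rewrite tnth0.
    by have := h (lift ord0 i); rewrite tnthS.
  case: h => /= hx ht i; case: (unliftP ord0 i) => [j ->|->].
    by rewrite tnthS; exact: ht.
  by rewrite tnth0.
have mB : measurable B.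
  have -> : B = \bigcap_(i in [set: 'I_n])
      ((fun t : n.-tuple Delta => tnth t i) @^-1` A (lift ord0 i)).
    by apply/seteqP; split => [t h i _|t h i]; [exact: h|exact: (h i I)].
  apply: fin_bigcap_measurable => // i _.
  by rewrite -[X in measurable X]setTI; apply: measurable_tnth => //; exact: mA.
by rewrite product_measure1E.
Qed.

End iid_law.

(* Main.v *)
(* The point g(xhat) is feasible for (CSP), hence lies componentwise below the
   optimal point xistar, and enlarging xi can only enlarge the violation set
   {y | ~ xi <= b(y)}. *)
Require Import Defs.
From mathcomp Require Import all_boot all_order all_algebra.
From mathcomp Require Import all_classical all_reals all_analysis.
Import Order.TTheory GRing.Theory Num.Theory.
Local Open Scope classical_set_scope.
Local Open Scope ring_scope.

(** (CSP) splits into one problem per component, so by [csp_optimalP] its optimum is the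
    componentwise minimum of the data, which dominates every feasible point
    ([csp_feasible_le_min]). *)

Theorem theorem2 (R : realType)
  (disp : measure_display) (Delta : measurableType disp) (P : probability Delta R)
  (d q N : nat) (hq : (0 < q)%N) (hN : (0 < N)%N)
  (X : set 'rV[R]_d) (f : X -> R) (g : X -> 'rV[R]_q) (b : Delta -> 'rV[R]_q)
  (hV : forall x : X, measurable (sp_violation g b x))
  (hV' : forall xi : 'rV[R]_q, measurable (csp_violation b xi))
  (hfeas : forall n : nat, (0 < n)%N ->
     \forall delta \ae iid_law P n, exists x : X, sp_feasible g b delta x)
  (delta : N.-tuple Delta)
  (xhat : X) (hxhat : sp_feasible g b delta xhat)
  (xistar : 'rV[R]_q) (hxistar : csp_optimal b delta xistar) :
  (sp_risk P g b xhat <= csp_risk P b xistar)%E.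
Proof.
(* [csp_min] seeds its minimum with the scenario at [ord0], hence a successor in place of [N]. *)
case: N hN delta hxhat hxistar => // n _ delta' xhatF /csp_optimalP xistarE.
have le_xistar : rv_le (g xhat) xistar.
  by rewrite xistarE; apply: csp_feasible_le_min => l i; exact: xhatF.
rewrite /sp_risk /csp_risk; apply: le_measure; rewrite ?inE//.
(* If [xistar] lies below [b y], so does [g xhat]; the missing link of the chain is [le_xistar]. *)
by move=> y; apply: contra_not => xistar_le l; exact: le_trans (xistar_le l).
Qed.
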